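(* Let $X\in\mathbb{R}^{n\times p}$, $y\in\mathbb{R}^n$ and $\lambda_1,\lambda_2>0$. Let $\hat\beta^{\lambda_1}$ be a Lasso solution with parameter $\lambda_1$ and let $\hat\beta^{\lambda_1,\lambda_2}$ be a Bregman Lasso refitting of it. Then $\hat\beta^{\lambda_1,\lambda_2}$ is a refitting of the Lasso solution $\hat\beta^{\lambda_1}$, that is, $\|y-X\hat\beta^{\lambda_1,\lambda_2}\|_2\le\|y-X\hat\beta^{\lambda_1}\|_2$.
   Context: A Lasso solution with parameter $\lambda_1>0$ is any $\hat\beta^{\lambda_1}\in\arg\min_{\beta\in\mathbb{R}^p}\frac{1}{2n}\|y-X\beta\|_2^2+\lambda_1\|\beta\|_1$. Put $\hat\rho^{\lambda_1}=\frac{1}{\lambda_1n}X^\top(y-X\hat\beta^{\lambda_1})$, which is a subgradient of $\|\cdot\|_1$ at $\hat\beta^{\lambda_1}$. The Bregman divergence of the $\ell_1$-norm is $D^{\rho}(z,w)=\|z\|_1-\|w\|_1-\langle\rho,z-w\rangle$ for $\rho\in\partial\|w\|_1$. A Bregman Lasso refitting is any $\hat\beta^{\lambda_1,\lambda_2}\in\arg\min_{\beta\in\mathbb{R}^p}\frac{1}{2n}\|y-X\beta\|_2^2+\lambda_2D^{\hat\rho^{\lambda_1}}(\beta,\hat\beta^{\lambda_1})$. *)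

(* Defs.v *)
From mathcomp Require Import all_boot all_order all_algebra.
From mathcomp Require Import reals.

Set Implicit Arguments.
Unset Strict Implicit.
Unset Printing Implicit Defensive.

Import Order.TTheory GRing.Theory Num.Theory.
Local Open Scope ring_scope.

Definition is_argmin (R : realType) (T : Type) (f : T -> R) (x : T) : Prop :=
  forall z : T, f x <= f z.

Definition inner (R : realType) (m : nat) (u v : 'cV[R]_m) : R :=
  \sum_(i < m) u i 0 * v i 0.

(* MathComp-Analysis norms 'cV[R]_m by the sup norm, so the l1 and l2 norms
   are defined here. *)
Definition l1norm (R : realType) (m : nat) (u : 'cV[R]_m) : R :=
  \sum_(i < m) `|u i 0|.

Definition l2norm (R : realType) (m : nat) (u : 'cV[R]_m) : R :=
  Num.sqrt (\sum_(i < m) u i 0 ^+ 2).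

Definition data_fit (R : realType) (n p : nat) (X : 'M[R]_(n, p))
    (y : 'cV[R]_n) (b : 'cV[R]_p) : R :=
  (2 * n%:R)^-1 * l2norm (y - X *m b) ^+ 2.

Definition lasso_solution (R : realType) (n p : nat) (X : 'M[R]_(n, p))
    (y : 'cV[R]_n) (lambda1 : R) (b1 : 'cV[R]_p) : Prop :=
  is_argmin (fun b => data_fit X y b + lambda1 * l1norm b) b1.

Definition lasso_subgradient (R : realType) (n p : nat) (X : 'M[R]_(n, p))
    (y : 'cV[R]_n) (lambda1 : R) (b1 : 'cV[R]_p) : 'cV[R]_p :=
  (lambda1 * n%:R)^-1 *: (X^T *m (y - X *m b1)).

(* The formula is total in rho; it is the Bregman divergence of the l1 norm
   when rho is a subgradient of the l1 norm at w.  For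
   rho = lasso_subgradient X y lambda1 b1 and w = b1, this holds by
   first-order optimality as soon as n and lambda1 are positive and b1 is a
   Lasso solution. *)
Definition bregman_l1 (R : realType) (p : nat) (rho z w : 'cV[R]_p) : R :=
  l1norm z - l1norm w - inner rho (z - w).

Definition bregman_lasso_refitting (R : realType) (n p : nat)
    (X : 'M[R]_(n, p)) (y : 'cV[R]_n) (lambda1 lambda2 : R)
    (b1 b2 : 'cV[R]_p) : Prop :=
  is_argmin (fun b => data_fit X y b
    + lambda2 * bregman_l1 (lasso_subgradient X y lambda1 b1) b b1) b2.

Definition is_refitting (R : realType) (n p : nat) (X : 'M[R]_(n, p))
    (y : 'cV[R]_n) (b1 b2 : 'cV[R]_p) : Prop :=
  l2norm (y - X *m b2) <= l2norm (y - X *m b1).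

(* Main.v *)
(** The Bregman divergence compares the refitting with the Lasso solution: since
    [D(b1, b1) = 0], minimality of [b2] gives
    [fit b2 + lambda2 * D(b2, b1) <= fit b1], so it suffices that
    [D(b2, b1) >= 0], that is, that [rho] is a subgradient of the l1 norm at
    [b1].  This is first-order optimality: comparing [b1] with
    [b1 + t (z - b1)] for [0 < t <= 1] and using convexity of the l1 norm gives
    [0 <= t lambda1 D(z, b1) + O(t^2)]; divide by [t] and let [t] tend to 0. *)
Require Import Defs.
From mathcomp Require Import all_boot all_order all_algebra.
From mathcomp Require Import reals.
From mathcomp Require Import ring lra.
Import Order.TTheory GRing.Theory Num.Theory.
Local Open Scope ring_scope.

Lemma l2norm_sqr (R : realType) (m : nat) (u : 'cV[R]_m) :
  l2norm u ^+ 2 = inner u u.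
Proof.
rewrite /l2norm sqr_sqrtr; last by apply: sumr_ge0 => i _; exact: sqr_ge0.
by apply: eq_bigr => i _; rewrite expr2.
Qed.

Lemma inner_ge0 (R : realType) (m : nat) (u : 'cV[R]_m) : 0 <= inner u u.
Proof. by rewrite -l2norm_sqr sqr_ge0. Qed.

Lemma innerE (R : realType) (m : nat) (u v : 'cV[R]_m) :
  inner u v = (u^T *m v) 0 0.
Proof. by rewrite mxE; apply: eq_bigr => i _; rewrite mxE. Qed.

Lemma innerZl (R : realType) (m : nat) (a : R) (u v : 'cV[R]_m) :
  inner (a *: u) v = a * inner u v.
Proof. by rewrite !innerE linearZ -scalemxAl mxE. Qed.

Lemma inner_trmx_mull (R : realType) (n p : nat) (X : 'M[R]_(n, p))
    (u : 'cV[R]_n) (v : 'cV[R]_p) :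
  inner (X^T *m u) v = inner u (X *m v).
Proof. by rewrite !innerE trmx_mul trmxK mulmxA. Qed.

Lemma inner_subZ (R : realType) (m : nat) (t : R) (u v : 'cV[R]_m) :
  inner (u - t *: v) (u - t *: v)
  = inner u u - 2 * t * inner u v + t ^+ 2 * inner v v.
Proof.
rewrite /inner !mulr_sumr -sumrB -big_split /=.
by apply: eq_bigr => i _; rewrite !mxE; ring.
Qed.

Lemma l1norm_convex (R : realType) (m : nat) (t : R) (w z : 'cV[R]_m) :
  0 <= t <= 1 -> l1norm (w + t *: (z - w)) <= (1 - t) * l1norm w + t * l1norm z.
Proof.
move=> /andP[t0 t1]; rewrite /l1norm !mulr_sumr -big_split /=.
apply: ler_sum => i _; rewrite !mxE.
rewrite (_ : w i 0 + _ = (1 - t) * w i 0 + t * z i 0); last by ring.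
apply: (le_trans (ler_normD _ _)).
by rewrite !normrM (ger0_norm t0) (@ger0_norm _ (1 - t)) ?subr_ge0.
Qed.

(** One explicit [t] replaces the limit: if [a < 0], then [a + t * k] is already negative for a
    suitable small [t]. *)
Lemma ge0_first_order (R : realFieldType) (a k : R) : 0 <= k ->
  (forall t, 0 < t <= 1 -> 0 <= t * a + t ^+ 2 * k) -> 0 <= a.
Proof.
move=> k0 H; rewrite leNgt; apply/negP => a0.
have d0 : 0 < k - a + 1 by lra.
(* Chosen so that [a + t * k = - t * (1 - a)], which is negative; [0 <= k] yields [t <= 1]. *)
pose t := - a / (k - a + 1).
have td : t * (k - a + 1) = - a by rewrite divfK ?gt_eqF.
have t0 : 0 < t by rewrite divr_gt0 ?oppr_gt0.
have t1 : t <= 1 by rewrite ler_pdivrMr // mul1r; lra.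
have := H t; rewrite t0 t1 => /(_ isT).
rewrite expr2 -mulrA -mulrDr pmulr_rge0 //; nra.
Qed.

Lemma bregman_lasso_ge0 (R : realType) (n p : nat) (X : 'M[R]_(n, p))
    (y : 'cV[R]_n) (lambda1 : R) (b1 z : 'cV[R]_p) :
  (0 < n)%N -> 0 < lambda1 -> lasso_solution X y lambda1 b1 ->
  0 <= bregman_l1 (lasso_subgradient X y lambda1 b1) z b1.
Proof.
move=> n0 l0 hb1.
have N0 : 0 < n%:R :> R by rewrite ltr0n.
rewrite /bregman_l1 innerZl inner_trmx_mull.
set r := y - X *m b1; set v := X *m (z - b1).
rewrite -(pmulr_rge0 _ l0).
(* The constant is the coefficient of [t ^+ 2] in the data fit along the segment from [b1] to
   [z]. *)
apply: (@ge0_first_order _ _ ((2 * n%:R)^-1 * inner v v)).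
  by rewrite mulr_ge0 ?inner_ge0 // invr_ge0 mulr_ge0 // ltW.
move=> t /andP[t0 t1].
have := hb1 (b1 + t *: (z - b1)).
rewrite /data_fit !l2norm_sqr mulmxDr -scalemxAr opprD addrA -/r -/v inner_subZ.
have := @l1norm_convex R p t b1 z; rewrite (ltW t0) t1 => /(_ isT).
rewrite -(ler_pM2l l0) => hconv hmin.
have {hconv hmin} h := le_trans hmin (lerD (lexx _) hconv).
rewrite -subr_ge0 in h; apply: le_trans h _.
(* Both sides agree: the cross term [- 2 * t * inner r v] of the fit, divided by [2 * n], is the
   [rho] term of [t * lambda1 * D(z, b1)]. *)
rewrite le_eqVlt; apply/orP; left; apply/eqP.
by field; rewrite !gt_eqF.
Qed.

Theorem proposition3 (R : realType) (n p : nat) (X : 'M[R]_(n, p))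
    (y : 'cV[R]_n) (lambda1 lambda2 : R)
    (hlambda1 : 0 < lambda1) (hlambda2 : 0 < lambda2)
    (b1 b2 : 'cV[R]_p)
    (hb1 : lasso_solution X y lambda1 b1)
    (hb2 : bregman_lasso_refitting X y lambda1 lambda2 b1 b2) :
  is_refitting X y b1 b2.
Proof.
(* For [n = 0] the factor [(2 * n%:R)^-1] is [0] by convention, so the fit carries no information;
   but both residuals are empty and have norm [0]. *)
case: n X y hb1 hb2 => [|n] X y hb1 hb2.
  by rewrite /is_refitting /l2norm !big_ord0.
have D0 := @bregman_lasso_ge0 _ _ _ _ _ _ _ b2 (ltn0Sn n) hlambda1 hb1.
have D1 : bregman_l1 (lasso_subgradient X y lambda1 b1) b1 b1 = 0.
  by rewrite /bregman_l1 !subrr innerE mulmx0 mxE subr0.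
have := hb2 b1; rewrite D1 mulr0 addr0.
move=> /(le_trans _) hfit.
have {hfit} : data_fit X y b2 <= data_fit X y b1.
  by apply: hfit; rewrite lerDl mulr_ge0 // ltW.
rewrite /data_fit ler_pM2l ?invr_gt0 ?mulr_gt0 ?ltr0n //.
by rewrite ler_sqr ?nnegrE ?sqrtr_ge0.
Qed.
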